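(* A maximum $5\times 5$ board configuration contains fifteen prisoners; that is, $P(5)=15$.
   Context: A configuration on an $n\times n$ board assigns to each of the $n^2$ squares exactly one occupant, either a prisoner or a guard. Two distinct squares are adjacent if one is directly above, below, to the left, to the right, or diagonal to the other (king-move adjacency). A configuration is valid (a valid board) if every square occupied by a prisoner is adjacent to at least as many squares occupied by guards as squares occupied by (other) prisoners. A maximum configuration (maximum board) is a valid board that has the greatest number of prisoners among all valid boards on the $n\times n$ board. $P(n)$ denotes the number of prisoners in a maximum configuration on the $n\times n$ board. *)

(* Defs.v *)
From mathcomp Require Import all_boot.

Set Implicit Arguments.
Unset Strict Implicit.
Unset Printing Implicit Defensive.

Definition square (n : nat) : finType := ('I_n * 'I_n)%type.

(* A configuration is given by the set of squares occupied by prisoners; every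
   other square is occupied by a guard. *)
Definition config (n : nat) : finType := {set square n}.

Definition prisoners n (C : config n) : {set square n} := C.
Definition guards n (C : config n) : {set square n} := ~: C.

(* |i - j| <= 1, avoiding truncated subtraction *)
Definition near1 (i j : nat) : bool := (i <= j.+1) && (j <= i.+1).

Definition adjacent n (s t : square n) : bool :=
  [&& s != t, near1 s.1 t.1 & near1 s.2 t.2].

Definition valid n (C : config n) : bool :=
  [forall s in prisoners C,
     #|[set t in prisoners C | adjacent s t]|
       <= #|[set t in guards C | adjacent s t]|].

Definition maximum_config n (C : config n) : Prop :=
  valid C /\ forall D : config n, valid D -> #|prisoners D| <= #|prisoners C|.

(* The all-guard configuration is valid, so the maximum is over a nonempty
   set. *)
Definition P (n : nat) : nat := \max_(C : config n | valid C) #|prisoners C|.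

(* Main.v *)
(* A board is valid iff each row is compatible with its two neighbouring rows,
   so the first two and the last two rows interact only with the middle one.
   Once the middle row is fixed, it is enough to know, for each compatible pair
   of outer rows, its number of prisoners and the row next to the middle; a
   finite computation over these data shows that 16 prisoners never fit.  The
   bound 15 is reached by filling the first, third and fifth columns. *)
Require Import Defs.
From mathcomp Require Import all_boot.

Set Implicit Arguments.
Unset Strict Implicit.
Unset Printing Implicit Defensive.

Definition near_count (p : pred bool) (j : nat) (r : seq bool) : nat :=
  count (fun k => near1 j k && p (nth false r k)) (iota 0 (size r)).

(* The square itself is counted among its own neighbours, hence the
   successor.  An empty row stands for a row outside the board: it contains
   neither prisoners nor guards. *)
Definition row_ok (a b c : seq bool) : bool :=
  all (fun j => nth false b j ==>
        (near_count id j a + near_count id j b + near_count id j c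
         <= (near_count negb j a + near_count negb j b
             + near_count negb j c).+1))
      (iota 0 (size b)).

(** Prepending [[::]] makes index [i] point to the row before row [i]; this and the default of [nth]
    supply the empty rows outside the board. *)
Definition board_ok (B : seq (seq bool)) : bool :=
  all (fun i => row_ok (nth [::] ([::] :: B) i) (nth [::] B i)
                       (nth [::] B i.+1))
      (iota 0 (size B)).

(** Turning the board upside down lets the two rows below the middle one be looked up in the same
    [half_boards] as the two above it. *)
Lemma row_okC a b c : row_ok a b c = row_ok c b a.
Proof.
have addnACl x y z : x + y + z = z + y + x by rewrite addnC [x + y]addnC addnA.
by apply: eq_all => j /=; rewrite addnACl [X in _ <= X.+1]addnACl.
Qed.

Definition row n (C : config n) (i : 'I_n) : seq bool :=
  [seq (i, j) \in C | j <- enum 'I_n].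

Definition board n (C : config n) : seq (seq bool) :=
  [seq row C i | i <- enum 'I_n].

Lemma size_row n (C : config n) i : size (row C i) = n.
Proof. by rewrite size_map size_enum_ord. Qed.

Lemma size_board n (C : config n) : size (board C) = n.
Proof. by rewrite size_map size_enum_ord. Qed.

Lemma nth_row n (C : config n) (i j : 'I_n) :
  nth false (row C i) j = ((i, j) \in C).
Proof. by rewrite (nth_map j) ?size_enum_ord // nth_ord_enum. Qed.

Lemma nth_board n (C : config n) (i : 'I_n) : nth [::] (board C) i = row C i.
Proof. by rewrite (nth_map i) ?size_enum_ord // nth_ord_enum. Qed.

Lemma near_count_row n (C : config n) (p : pred bool) (i : 'I_n) j :
  near_count p j (row C i) = \sum_(k < n | near1 j k) p ((i, k) \in C).
Proof.
rewrite /near_count size_row -sum1_count -{1}(subn0 n) -/(index_iota 0 n).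
rewrite big_mkord big_mkcondr /=; apply: eq_bigr => k _.
by rewrite nth_row; case: (p _).
Qed.

(** The indices near [i] are [i] and its two neighbours; as [F x0 = 0], a neighbour missing at
    either end may be read as the default [x0]. *)
Lemma sum_near (T : Type) (x0 : T) (F : T -> nat) (s : seq T) (i : nat) :
  F x0 = 0 -> i < size s ->
  \sum_(k < size s | near1 i k) F (nth x0 s k)
    = F (nth x0 (x0 :: s) i) + F (nth x0 s i) + F (nth x0 s i.+1).
Proof.
move=> F0; elim: s i => [//|x s IHs] [|i] /= lt_i_s.
  rewrite big_mkcond big_ord_recl /= F0; congr (_ + _).
  case: s {IHs lt_i_s} => [|y s]; first by rewrite big_ord0 F0.
  by rewrite big_ord_recl /= big1 ?addn0.
rewrite big_mkcond big_ord_recl /= -big_mkcond /=.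
have -> : \sum_(k < size s | near1 i.+1 (lift ord0 k)) F (nth x0 s k)
            = \sum_(k < size s | near1 i k) F (nth x0 s k) by [].
(* The head is near [i.+1] only for [i = 0], where it replaces the default that the induction
   hypothesis puts before the tail. *)
by rewrite IHs //; case: i {IHs lt_i_s} => [|i] /=; rewrite ?F0 ?add0n ?addnA.
Qed.

(** Taking [id] or [negb] for [p] gives the prisoners or the guards in the block around [(i, j)],
    centre included. *)
Lemma card_near n (C : config n) (p : pred bool) (i j : 'I_n) :
  #|[set t : square n | [&& p (t \in C), near1 i t.1 & near1 j t.2]]|
    = near_count p j (nth [::] ([::] :: board C) i)
      + near_count p j (nth [::] (board C) i)
      + near_count p j (nth [::] (board C) i.+1).
Proof.
rewrite -(sum_near (F := near_count p j)) ?size_board //.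
under eq_bigr do rewrite nth_board near_count_row.
rewrite pair_big /= -sum1_card big_mkcond [RHS]big_mkcond /=.
apply: eq_bigr => -[k l] _; rewrite inE /=.
by case: (near1 i k); case: (near1 j l); case: (p _).
Qed.

Lemma valid_boardE n (C : config n) : valid C = board_ok (board C).
Proof.
have nearxx (k : nat) : near1 k k by rewrite /near1 leqnSn.
have okP (s : square n) : s \in C ->
    (#|[set t in prisoners C | adjacent s t]|
       <= #|[set t in guards C | adjacent s t]|)
    = (near_count id s.2 (nth [::] ([::] :: board C) s.1)
       + near_count id s.2 (nth [::] (board C) s.1)
       + near_count id s.2 (nth [::] (board C) s.1.+1)
       <= (near_count negb s.2 (nth [::] ([::] :: board C) s.1)
           + near_count negb s.2 (nth [::] (board C) s.1)
           + near_count negb s.2 (nth [::] (board C) s.1.+1)).+1).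
  (* The prisoner on [s] lies in its own block; taking it out cancels the successor on the guard
     side. *)
  move=> sC; rewrite -!card_near [in RHS](cardsD1 s) inE sC !nearxx add1n ltnS.
  congr (_ <= _); apply: eq_card => t; rewrite !inE /adjacent.
    by rewrite [t == s]eq_sym; case: (s == t); rewrite ?andbF.
  by case: eqVneq => [<-|_] //=; rewrite sC.
apply/forall_inP/allP => [ok i | ok [i j] sC].
  rewrite mem_iota size_board => /= lt_i_n; apply/allP => j.
  rewrite (nth_board C (Ordinal lt_i_n)) size_row mem_iota => /= lt_j_n.
  rewrite (nth_row C _ (Ordinal lt_j_n)); apply/implyP => sC.
  by have := ok _ sC; rewrite okP //= (nth_board C (Ordinal lt_i_n)).
rewrite okP //=.
have /ok /allP/(_ (val j)) : val i \in iota 0 (size (board C)).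
  by rewrite mem_iota size_board /=.
by rewrite !nth_board size_row mem_iota nth_row sC /=; apply; apply: ltn_ord.
Qed.

Lemma card_board n (C : config n) :
  #|C| = sumn [seq count id r | r <- board C].
Proof.
rewrite sumnE 2!big_map big_enum -sum1_card.
under [RHS]eq_bigr => i _.
  rewrite -sum1_count big_mkcond big_map big_enum; over.
rewrite pair_big big_mkcond /=; apply: eq_bigr => -[i j] _ /=.
by case: (_ \in C).
Qed.

Fixpoint all_rows (n : nat) : seq (seq bool) :=
  if n is m.+1 then [seq b :: r | b <- [:: true; false], r <- all_rows m]
  else [:: [::]].

Lemma mem_all_rows n r : size r = n -> r \in all_rows n.
Proof.
move<-; elim: r => [//|b r IHr].
by rewrite /= cats0 mem_cat; case: b; rewrite map_f ?orbT.
Qed.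

(** [undup] merges outer rows that leave the same data, which shortens the search over pairs of
    halves. *)
Definition half_boards (m : seq bool) : seq (nat * seq bool) :=
  undup [seq (count id ab.1 + count id ab.2, ab.2)
        | ab <- [seq (a, b) | a <- all_rows 5, b <- all_rows 5]
        & row_ok [::] ab.1 ab.2 && row_ok ab.1 ab.2 m].

Lemma mem_half_boards a b m :
  size a = 5 -> size b = 5 -> row_ok [::] a b -> row_ok a b m ->
  (count id a + count id b, b) \in half_boards m.
Proof.
move=> sa sb okab okabm; rewrite mem_undup.
apply/mapP; exists (a, b) => //; rewrite mem_filter okab okabm !andTb.
exact: allpairs_f (mem_all_rows sa) (mem_all_rows sb).
Qed.

(* The conditional keeps the call-by-value evaluation from testing [row_ok] on
   pairs of halves that have few prisoners anyway. *)
Definition halves_bound (m : seq bool) : bool :=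
  let h := half_boards m in
  all (fun p => all (fun q =>
    if p.1 + count id m + q.1 <= 15 then true else ~~ row_ok p.2 m q.2) h) h.

Lemma all_halves_bound : all halves_bound (all_rows 5).
Proof. by vm_compute. Qed.

Lemma valid5_bound (C : config 5) : valid C -> #|C| <= 15.
Proof.
rewrite valid_boardE card_board.
have : all (fun r => size r == 5) (board C).
  by apply/allP => _ /mapP[i _ ->]; rewrite size_row.
have := size_board C.
case: (board C) => [|a [|b [|m [|d [|e []]]]]] //= _.
case/and5P=> /eqP sa /eqP sb /eqP sm /eqP sd /andP[/eqP se _].
case/and5P=> /= ok1 ok2 ok3 ok4 /andP[ok5 _].
rewrite row_okC in ok4; rewrite row_okC in ok5.
have m5 := mem_all_rows sm.
have /allP/(_ _ (mem_half_boards sa sb ok1 ok2)) := allP all_halves_bound m m5.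
move/allP/(_ _ (mem_half_boards se sd ok5 ok4)); rewrite /= ok3.
by case: ifP => // + _; rewrite addn0 [count id d + _]addnC !addnA.
Qed.

Definition even_columns : config 5 := [set s : square 5 | ~~ odd s.2].

Lemma board_even_columns :
  board even_columns = nseq 5 [:: true; false; true; false; true].
Proof.
have rowE i : row even_columns i = [:: true; false; true; false; true].
  rewrite /row; under eq_map do rewrite inE /=.
  by rewrite (map_comp (fun k => ~~ odd k) val) val_enum_ord.
by rewrite /board (eq_map rowE) (map_comp (fun=> _) val) val_enum_ord.
Qed.

(** A prisoner here is adjacent to prisoners of its own column only, and a single neighbouring
    column of guards already outnumbers them. *)
Lemma valid_even_columns : valid even_columns.
Proof. by rewrite valid_boardE board_even_columns. Qed.

Lemma card_even_columns : #|even_columns| = 15.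
Proof. by rewrite card_board board_even_columns. Qed.

Theorem proposition3p2 :
  (forall C : config 5, maximum_config C -> #|prisoners C| = 15) /\ P 5 = 15.
Proof.
split=> [C [validC maxC]|]; apply/eqP; rewrite eqn_leq.
  by rewrite valid5_bound // -card_even_columns maxC // valid_even_columns.
apply/andP; split; first by apply/bigmax_leqP => C /valid5_bound.
by rewrite -card_even_columns (leq_bigmax_cond _ valid_even_columns).
Qed.
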